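(* Let $q$ be a prime power and let $k\ge 2$ and $t\ge 0$ be fixed integers. For $d\ge 0$ put $$A_k(d)=\sum_{\substack{a_1,\dots,a_d\ge 0\\ 1a_1+2a_2+\cdots+da_d=d}}(-1)^{a_1+\cdots+a_d}\binom{I_k(1)}{a_1}\cdots\binom{I_k(d)}{a_d}$$ (so $A_k(0)=1$). Then for integers $m,n\ge 0$, $$P_k(m;n)=\sum_{d=0}^t N_k(m-d)N_k(n-d)A_k(d)+O\bigl(N_k(m-t-1)N_k(n-t-1)\bigr),$$ where the constant in the $O$-term depends only on $q,k,t$ (and not on $m,n$).
   Context: $\mathbb F_q$ is the finite field with $q$ elements. Two polynomials in $\mathbb F_q[x_1,\dots,x_k]$ are identified if they differ by a factor in $\mathbb F_q^\times$; the classes are called normalized polynomials. For an integer $m\ge 0$, $\mathcal N_k(m)$ is the set of normalized (nonzero) polynomials in $\mathbb F_q[x_1,\dots,x_k]$ of total degree $m$, and $N_k(m)=|\mathcal N_k(m)|$; $N_k(m)=0$ for $m<0$. $I_k(m)$ is the number of irreducible elements of $\mathcal N_k(m)$. For $m,n\ge 0$, $P_k(m;n)=|\{(f,g)\in\mathcal N_k(m)\times\mathcal N_k(n):\gcd(f,g)=1\}|$. *)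

(* Defs.v *)
From mathcomp Require Import all_boot all_order all_algebra.
From mathcomp Require Import boolp.
From mathcomp Require Import mpoly.

Set Implicit Arguments.
Unset Strict Implicit.
Unset Printing Implicit Defensive.

Import GRing.Theory.
Local Open Scope ring_scope.

(* [mpoly] has no divisibility, irreducibility or gcd: the notions below are
   the usual ones of a commutative integral domain. *)
Section Divisibility.
Variable R : idomainType.
Implicit Types f g d e : R.

Definition divides d f : Prop := exists e, f = e * d.

Definition irreducible f : Prop :=
  [/\ f != 0, f \isn't a GRing.unit &
      forall g e, f = g * e -> g \is a GRing.unit \/ e \is a GRing.unit].

Definition is_gcd f g d : Prop :=
  [/\ divides d f, divides d g &
      forall e, divides e f -> divides e g -> divides e d].

End Divisibility.

Section Counting.
Variables (F : finFieldType) (k : nat).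

(* The polynomials of total degree at most m form a finite type through their
   coefficient families, indexed by the monomials of degree < m.+1. *)
Local Notation coeffs m := {ffun 'X_{1..k < m.+1} -> F}.

Definition poly_of (m : nat) (a : coeffs m) : {mpoly F[k]} :=
  \sum_(u : 'X_{1..k < m.+1}) a u *: 'X_[u].

(* [msize p = m.+1] holds iff p is nonzero of total degree m. *)
Definition of_degree (m : nat) : {set coeffs m} :=
  [set a | msize (poly_of a) == m.+1].

Definition scalar_eq (m : nat) : rel (coeffs m) :=
  fun a b => [exists c : F, (c != 0) && (poly_of b == c *: poly_of a)].

(* A normalized polynomial is an equivalence class. *)
Definition normalized (m : nat) : {set {set coeffs m}} :=
  equivalence_partition (@scalar_eq m) (of_degree m).

(* Extended by 0 to negative degrees. *)
Definition Nk (z : int) : nat :=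
  if z is Posz m then #|normalized m| else 0%N.

(* Irreducibility and coprimality do not depend on the representatives. *)
Definition Ik (m : nat) : nat :=
  #|[set X in normalized m |
      `[< exists2 a, a \in X & irreducible (poly_of a) >]]|.

Definition Pk (m n : nat) : nat :=
  #|[set XY in setX (normalized m) (normalized n) |
      `[< exists a b, [/\ a \in XY.1, b \in XY.2 &
                          is_gcd (poly_of a) (poly_of b) 1] >]]|.

(* The index i : 'I_d stands for i.+1; the constraint on the sum forces every
   a_i <= d, so the a_i may be taken in 'I_d.+1. *)
Definition Ak (d : nat) : int :=
  \sum_(a : {ffun 'I_d -> 'I_d.+1} | (\sum_(i < d) i.+1 * a i == d)%N)
     (-1) ^+ (\sum_(i < d) a i)%N * \prod_(i < d) ('C(Ik i.+1, a i))%:Z.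

End Counting.

(* Main.v *)
Require Import Defs.
From mathcomp Require Import all_boot all_order all_algebra.
From mathcomp Require Import boolp zify ring.
From mathcomp Require Import mpoly.

(** A pair of polynomials is coprime iff no irreducible polynomial divides both
    members. Removing the multiples of one irreducible p after another from all
    pairs of degrees (m, n) multiplies the generating function by
    [1 - T ^ deg p] at each step, because irreducible polynomials are prime and
    multiplication by p is a bijection onto the multiples of p. The product of
    these factors is the series of the [A(d)], which yields the exact identity
    [P(m; n) = \sum_(d <= min(m, n)) N(m - d) N(n - d) A(d)]. The same sieve
    applied to single polynomials shows that [A] is the convolution inverse of
    [N], whence [|A(d)| <= q ^ (2 d + b d - 1)] with [b d = 'C(d + k, k)] the
    number of monomials of degree at most d. Since [b] is superadditive up to 1
    and, for [k >= 2], [b (e + t + 1) + 3 e <= 2 b e + O(1)], the terms with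
    [d = t + 1 + e] are [O(2 ^ - e)] times the first omitted one. *)

Set Implicit Arguments.
Unset Strict Implicit.
Unset Printing Implicit Defensive.

Import Order.TTheory GRing.Theory Num.Theory.
Local Open Scope ring_scope.

(** * Unique factorization *)

Section Factorial.
Variable R : idomainType.
Implicit Types (c p f g : R).

Definition prime_elt p := forall f g, divides p (f * g) -> divides p f \/ divides p g.

Definition irreducibles_prime := forall p, irreducible p -> prime_elt p.

(** Existence of factorizations; together with [irreducibles_prime] it makes [R] factorial. *)
Definition atomic := forall c, c != 0 ->
  exists u (s : seq R), [/\ u \is a GRing.unit,
    forall r, r \in s -> irreducible r & c = u * \prod_(r <- s) r].

Lemma divides_refl f : divides f f.
Proof. by exists 1; rewrite mul1r. Qed.

Lemma divides_mull f g p : divides p f -> divides p (g * f).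
Proof. by case=> e ->; exists (g * e); rewrite mulrA. Qed.

Lemma divides_trans g p f : divides p g -> divides g f -> divides p f.
Proof. by move=> pg [e ->]; apply: divides_mull. Qed.

Lemma divides_unit f u : u \is a GRing.unit -> divides u f.
Proof. by move=> Uu; exists (f / u); rewrite mulrVK. Qed.

Lemma unit_divides u f : u \is a GRing.unit -> divides f u -> f \is a GRing.unit.
Proof. by move=> Uu [e eu]; move: Uu; rewrite eu unitrM => /andP[]. Qed.

End Factorial.

(** * Gauss's lemma for univariate polynomials *)

Section PolyFactorial.
Variable R : idomainType.
Hypotheses (atomicR : atomic R) (primeR : irreducibles_prime R).
Implicit Types (c : R) (p f g h d : {poly R}).

Lemma divides_polyC c f : divides c%:P f <-> forall i, divides c f`_i.
Proof.
split=> [[e ->] i|cf]; first by exists e`_i; rewrite coefMC.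
have [e fe] := choice cf.
exists (\poly_(i < size f) e i); apply/polyP=> i; rewrite coefMC coef_poly.
by case: ltnP => [_|/(nth_default 0)->]; rewrite ?mul0r.
Qed.

Lemma prime_polyC c : prime_elt c -> prime_elt c%:P.
Proof.
move=> pc f g; move: {2}(size f + size g)%N (leqnn (size f + size g)) => n.
elim: n => [|n IHn] in f g *.
  rewrite leqn0 addn_eq0 size_poly_eq0 => /andP[/eqP-> _] _.
  by left; exists 0; rewrite mul0r.
move=> le_fg cfg.
have reduce f1 g1 : (size f1 + size g1 <= n.+1)%N -> divides c%:P (f1 * g1) ->
    divides c f1`_0 -> divides c%:P f1 \/ divides c%:P g1.
  elim/poly_ind: f1 => [|f1 a _]; first by left; exists 0; rewrite mul0r.
  move=> le_n cfg1; rewrite coefD coefMX coefC !eqxx add0r => ca.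
  have [f1_0|f1_nz] := eqVneq f1 0.
    left; apply/divides_polyC=> i; rewrite f1_0 mul0r add0r coefC.
    by case: ifP => // _; exists 0; rewrite mul0r.
  have: divides c%:P (f1 * g1).
    apply/divides_polyC=> i; have [e eE] := ca.
    have [h] := (proj1 (divides_polyC _ _) cfg1) i.+1.
    rewrite mulrDl mulrAC coefD coefMX /= coefCM eE => fgE.
    by exists (h - e * g1`_i.+1); rewrite mulrBl -fgE [e * _ * c]mulrAC addrK.
  case/IHn => [||cg]; last by right.
    rewrite size_MXaddC (negPf f1_nz) /= in le_n.
    by move: le_n; rewrite addSn ltnS.
  move=> /divides_polyC cf1; left; apply/divides_polyC=> i.
  rewrite coefD coefMX coefC; case: i => [|i] //=; first by rewrite add0r.
  by rewrite addr0.
case: (pc f`_0 g`_0) => [||cg].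
- by move/divides_polyC/(_ 0%N): cfg; rewrite coef0M.
- exact: reduce.
by case: (reduce g f); rewrite ?[g * f]mulrC 1?addnC; auto.
Qed.

(* Over an integral domain, [p %| f] of polydiv only means that p divides some
   nonzero constant multiple of f; the constant is removed one irreducible
   factor at a time. *)
Lemma cancel_constant c p f h :
    (forall r, irreducible r -> ~ divides r%:P p) -> c != 0 ->
  c *: f = h * p -> divides p f.
Proof.
move=> prim_p /atomicR[u [s [Uu irr_s ->]]].
elim: s => [|r s IHs] in h irr_s *.
  rewrite big_nil mulr1 => fE; exists (u^-1 *: h).
  by rewrite -scalerAl -fE scalerA mulVr ?scale1r.
have irr_r : irreducible r by apply: irr_s; rewrite mem_head.
have r_nz : r%:P != 0 by rewrite polyC_eq0; case: irr_r.
rewrite big_cons mulrCA -scalerA -mul_polyC => fE.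
have [|[h' hE]|/prim_p//] := prime_polyC (primeR irr_r) (f := h) (g := p).
  by exists ((u * \prod_(j <- s) j) *: f); rewrite -fE mulrC.
apply: (IHs h') => [r' r's|]; first by apply: irr_s; rewrite inE r's orbT.
by apply: (mulfI r_nz); rewrite fE hE mulrCA mulrA.
Qed.

(** A factorization over the fraction field descends to [R]: each irreducible factor of [c] is
    prime, so it divides [h] or [d] and cancels there without changing a size. *)
Lemma integral_factors c p h d : c != 0 -> c *: p = h * d ->
  exists h' d', [/\ p = h' * d', size h' = size h & size d' = size d].
Proof.
move=> /atomicR[u [s [Uu irr_s ->]]].
elim: s => [|r s IHs] in h d irr_s *.
  rewrite big_nil mulr1 => pE; exists (u^-1 *: h), d; split=> //.
    by rewrite -scalerAl -pE scalerA mulVr ?scale1r.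
  by rewrite size_scale ?invr_eq0 //; apply: contraTneq Uu => ->; rewrite unitr0.
have irr_r : irreducible r by apply: irr_s; rewrite mem_head.
have r_nz : r != 0 by case: irr_r.
have rP_nz : r%:P != 0 by rewrite polyC_eq0.
have irr_s' r' : r' \in s -> irreducible r'.
  by move=> r's; apply: irr_s; rewrite inE r's orbT.
rewrite big_cons mulrCA -scalerA -mul_polyC => pE.
have [||] := prime_polyC (primeR irr_r) (f := h) (g := d).
- by exists ((u * \prod_(j <- s) j) *: p); rewrite -pE mulrC.
- move=> [h' hE]; have [|h1 [d1 [pE1 h1E d1E]]] := IHs h' d irr_s'.
    by apply: (mulfI rP_nz); rewrite pE hE mulrCA mulrA.
  by exists h1, d1; rewrite pE1 h1E d1E hE [_ * r%:P]mulrC mul_polyC size_scale.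
move=> [d' dE]; have [|h1 [d1 [pE1 h1E d1E]]] := IHs h d' irr_s'.
  by apply: (mulfI rP_nz); rewrite pE dE mulrA mulrC.
by exists h1, d1; rewrite pE1 h1E d1E dE [_ * r%:P]mulrC mul_polyC size_scale.
Qed.

(** Constants are handled by [prime_polyC]. A nonconstant irreducible [p] has no irreducible
    constant factor, and [gcdp p f] has either the size of [p], so that [p] divides [f], or size 1,
    so that [p] divides [g]. *)
Lemma irreducibles_prime_poly : irreducibles_prime {poly R}.
Proof.
move=> p [p_nz p_nu p_irr]; have [p_le1|p_gt1] := leqP (size p) 1.
  have [c pE] : exists c, p = c%:P by exists p`_0; apply: size1_polyC.
  rewrite {}pE polyC_eq0 in p_nz p_nu p_irr *; apply/prime_polyC/primeR.
  have unitC (a : R) : (a%:P \is a GRing.unit) = (a \is a GRing.unit).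
    rewrite poly_unitE size_polyC coefC eqxx.
    by have [->|] := eqVneq a 0; rewrite ?unitr0.
  split=> // [|a b cE]; first by rewrite -unitC.
  by rewrite -!unitC; apply: p_irr; rewrite cE polyCM.
have unit_size1 f : f \is a GRing.unit -> size f = 1%N.
  by rewrite poly_unitE => /andP[/eqP].
have prim_p r : irreducible r -> ~ divides r%:P p.
  case=> r_nz r_nu _ [e pE]; have [/unit_size1 e1|] := p_irr _ _ pE.
    by move: p_gt1; rewrite pE mulrC mul_polyC size_scale // e1.
  by rewrite poly_unitE coefC (negPf r_nu) andbF.
move=> f g [e fgE].
have dvd_fg : (p %| f * g)%R by rewrite fgE dvdp_mull.
pose d := gcdp p f.
have /Pdiv.Idomain.dvdpP[[c h] /= c_nz pE] : (d %| p)%R by apply: dvdp_gcdl.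
(* Irreducibility of [p] concerns factorizations over [R], so the one through the gcd, valid up to
   the constant [c], is first made integral. *)
have [h' [d' [pE' h'1 d'1]]] := integral_factors c_nz pE.
have [Uh|Ud] := p_irr _ _ pE'.
  left; have d_p : (d %= p)%R.
    rewrite -dvdp_size_eqp ?dvdp_gcdl // -d'1 pE'.
    have [a a_nz ->] : exists2 a, a != 0 & h' = a%:P.
      have h1 := unit_size1 _ Uh; exists h'`_0; last by apply: size1_polyC; rewrite h1.
      by apply: contraTneq Uh => h0; rewrite poly_unitE h0 unitr0 andbF.
    by rewrite mul_polyC size_scale.
  have /Pdiv.Idomain.dvdpP[[c' h2] /= c'_nz fE] : (p %| f)%R.
    by rewrite -(eqp_dvdl _ d_p) dvdp_gcdr.
  exact: cancel_constant prim_p c'_nz fE.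
right; have /Pdiv.Idomain.dvdpP[[c' h2] /= c'_nz gE] : (p %| g)%R.
  by rewrite -(@Gauss_dvdpr _ g f p) // /coprimep -/d -d'1 unit_size1.
exact: cancel_constant prim_p c'_nz gE.
Qed.

End PolyFactorial.

(** * From one variable to several *)

Section MpolyFactorial.
Variable F : fieldType.

Lemma muni_widen n (c : {mpoly F[n]}) : muni (mwiden c) = c%:P.
Proof.
rewrite [c]mpolyE (raddf_sum (@mwiden n F)) (raddf_sum (@muni n F)) (raddf_sum polyC) /=.
apply: eq_bigr => m _.
rewrite mwidenZ muniZ mwidenX muniE msuppX big_seq1 mcoeffX eqxx scale1r.
rewrite mnmwiden_ordmax expr0 alg_polyC -mul_polyC -polyCM mul_mpolyC.
by congr (_ *: 'X_[_])%:P; apply/mnmP=> i; rewrite mnmE mnmwiden_widen.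
Qed.

Lemma muni_ordmax n : muni 'X_ord_max = 'X :> {poly {mpoly F[n]}}.
Proof.
rewrite muniE msuppX big_seq1 mcoeffX eqxx scale1r.
rewrite mnm1E eqxx expr1 (_ : [multinom _ | i < n] = 0%MM).
  by rewrite mpolyX0 scale1r.
apply/mnmP=> i; rewrite !mnmE; case: eqP => // /(congr1 val) /= /eqP.
by rewrite eq_sym ltn_eqF.
Qed.

Lemma mmultiK n : cancel (@mmulti n F) (@muni n F).
Proof.
move=> P; rewrite /mmulti raddf_sum /= -[RHS]coefK poly_def.
apply: eq_bigr => i _.
by rewrite muniM rmorphXn /= muni_widen muni_ordmax mul_polyC.
Qed.

(** Every coefficient of [p] is read off [muni p], first by the exponent of the last variable, then
    by the others. With [mmultiK] this makes [muni] a ring isomorphism onto [{poly {mpoly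
    F[n]}}]. *)
Lemma muni_inj n : injective (@muni n F).
Proof.
pose trunc (m : 'X_{1..n.+1}) := [multinom m (widen_ord (leqnSn n) i) | i < n].
have coefE (p : {mpoly F[n.+1]}) m : ((muni p)`_(m ord_max))@_(trunc m) = p@_m.
  rewrite muniE coef_sum raddf_sum /= [in RHS](mpolyE p) raddf_sum /=.
  apply: eq_bigr => m' _; rewrite coefZ coefXn [RHS]mcoeffZ mcoeffX.
  have [eq_max|ne_max] := eqVneq (m ord_max) (m' ord_max); last first.
    rewrite mulr0 mcoeff0; case: eqP => [eq_m|]; last by rewrite mulr0.
    by rewrite eq_m eqxx in ne_max.
  rewrite mulr1 mcoeffZ mcoeffX; congr (_ * (nat_of_bool _)%:R).
  apply/eqP/eqP=> [/mnmP eq_tr|-> //]; apply/mnmP=> i.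
  case: (unliftP ord_max i) => [j ->|-> //].
  have := eq_tr j; rewrite !mnmE (_ : widen_ord _ j = lift ord_max j) //.
  by apply: val_inj; rewrite /= /bump leqNgt ltn_ord.
by move=> p q eq_pq; apply/mpolyP=> m; rewrite -!coefE eq_pq.
Qed.

Lemma mpoly_unitE n (p : {mpoly F[n]}) : (p \is a GRing.unit) = (msize p == 1%N).
Proof.
apply/andP/msize_poly1P => [[/eqP pE Up]|[c c_nz ->]].
  by exists p@_0; rewrite // -unitfE.
by rewrite mcoeffC eqxx mulr1 unitfE.
Qed.

(** Induction on the degree: nonzero nonunits have positive degree, so both factors of a reducible
    polynomial have smaller degree. *)
Lemma atomic_mpoly n : atomic {mpoly F[n]}.
Proof.
move=> p; have [m] := ubnP (msize p); elim: m => // m IHm in p *.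
rewrite ltnS => p_lt p_nz.
have [Up|Up] := boolP (p \is a GRing.unit).
  by exists p, [::]; rewrite big_nil mulr1.
have [irr_p|red_p] := pselect (irreducible p).
  exists 1, [:: p]; rewrite big_seq1 mul1r unitr1; split=> // r.
  by rewrite inE => /eqP->.
have [g [e [pE Ug Ue]]] : exists g e, [/\ p = g * e, g \isn't a GRing.unit &
    e \isn't a GRing.unit].
  apply: contrapT => nofac; apply: red_p; split=> // g e pE.
  apply/orP; apply: contraT; rewrite negb_or => /andP[Ug Ue].
  by case: nofac; exists g, e.
have [g_nz e_nz] : g != 0 /\ e != 0.
  by apply/andP; rewrite -negb_or -mulf_eq0 -pE.
move: Ug Ue; rewrite !mpoly_unitE => g1 e1.
have g_gt0 := mpolySpred mdeg g_nz; have e_gt0 := mpolySpred mdeg e_nz.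
have sz : (msize g < m)%N /\ (msize e < m)%N.
  move: p_lt; rewrite pE msizeM //; rewrite g_gt0 e_gt0 !eqSS in g1 e1 *.
  rewrite addSn addnS -!lt0n in g1 e1 * => /= lt_m.
  split; apply: leq_trans lt_m; rewrite ltnS.
    by rewrite -[X in (X < _)%N]addn0 ltn_add2l.
  by rewrite -[X in (X < _)%N]add0n ltn_add2r.
have [u1 [s1 [Uu1 irr1 gE]]] := IHm g sz.1 g_nz.
have [u2 [s2 [Uu2 irr2 eE]]] := IHm e sz.2 e_nz.
exists (u1 * u2), (s1 ++ s2); split.
- by rewrite unitrM Uu1.
- by move=> r; rewrite mem_cat => /orP[/irr1|/irr2].
- by rewrite pE gE eE big_cat mulrACA.
Qed.

(** Induction on the number of variables along the isomorphism [muni]. Without variables every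
    nonzero polynomial is a unit and nothing is irreducible. *)
Lemma irreducibles_prime_mpoly n : irreducibles_prime {mpoly F[n]}.
Proof.
elim: n => [|n IHn] p [p_nz p_nu p_irr].
  move: p_nu; rewrite mpoly_unitE (nvar0_mpolyC p) msizeC.
  by rewrite -(mpolyC_eq0 0) -nvar0_mpolyC p_nz.
have unitE (q : {mpoly F[n.+1]}) : (muni q \is a GRing.unit) = (q \is a GRing.unit).
  apply/idP/idP=> /unitrP[r [rq qr]]; apply/unitrP.
    by exists (mmulti r); split; apply: muni_inj; rewrite muniM mmultiK ?rq ?qr muni1.
  by exists (muni r); split; [rewrite -(muniM r q) rq | rewrite -(muniM q r) qr]; apply: muni1.
have divE (f g : {mpoly F[n.+1]}) : divides (muni f) (muni g) <-> divides f g.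
  split=> [[e gE]|[e ->]]; last by exists (muni e); rewrite muniM.
  by exists (mmulti e); apply: muni_inj; rewrite muniM mmultiK.
have prime_p : prime_elt (muni p).
  apply: (irreducibles_prime_poly (@atomic_mpoly n) IHn).
  split=> [||g e gE]; first by rewrite -(inj_eq (@muni_inj n)) muni0 in p_nz.
    by rewrite unitE.
  have := p_irr (mmulti g) (mmulti e); rewrite -!unitE !mmultiK; apply.
  by apply: muni_inj; rewrite muniM !mmultiK.
by move=> f g /divE; rewrite muniM => /prime_p[]/divE; [left|right].
Qed.

End MpolyFactorial.

(** * Monic representatives *)

Definition common_divisor (R : idomainType) (p : R) (fg : R * R) : bool :=
  `[< divides p fg.1 /\ divides p fg.2 >].

Section Scalars.
Variables (F : finFieldType) (k : nat).
Implicit Types (p f g : {mpoly F[k]}) (c : F).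

Lemma mleadc_scale c p : mleadc (c *: p) = c * mleadc p.
Proof. exact: mleadcZE. Qed.

Lemma msize_scale c p : c != 0 -> msize (c *: p) = msize p.
Proof. exact: msizeZ. Qed.

Lemma divides_scale c p f : c != 0 -> divides p (c *: f) <-> divides p f.
Proof.
move=> c_nz; split=> [[e fE]|[e ->]]; last by exists (c *: e); rewrite scalerAl.
by exists (c^-1 *: e); rewrite -scalerAl -fE scalerA mulVf ?scale1r.
Qed.

Lemma irreducible_scale c f : c != 0 -> irreducible (c *: f) <-> irreducible f.
Proof.
suff imp (a : F) (h : {mpoly F[k]}) : a != 0 -> irreducible h -> irreducible (a *: h).
  move=> c_nz; split=> [irr|]; last exact: imp.
  by rewrite -[f]scale1r -(mulVf c_nz) -scalerA; apply: imp; rewrite ?invr_eq0.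
move=> a_nz [h_nz h_nu h_irr]; split=> [||g e hE].
- by rewrite mscalerI negb_or a_nz.
- by rewrite mpoly_unitE msize_scale // -mpoly_unitE.
have /h_irr[] : h = (a^-1 *: g) * e by rewrite -scalerAl -hE scalerA mulVf ?scale1r.
  by rewrite !mpoly_unitE msize_scale ?invr_eq0 //; left.
by right.
Qed.

Lemma is_gcd1P f g :
  is_gcd f g 1 <-> (forall e, common_divisor e (f, g) -> e \is a GRing.unit).
Proof.
split=> [[_ _ gcdP] e /asboolP[ef eg]|coP].
  by have := gcdP _ ef eg; apply: unit_divides; rewrite unitr1.
split=> [||e ef eg]; try exact/divides_unit/unitr1.
by apply/divides_unit/coP/asboolP.
Qed.

Lemma is_gcd1_scale c d f g : c != 0 -> d != 0 ->
  is_gcd (c *: f) (d *: g) 1 <-> is_gcd f g 1.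
Proof.
move=> c_nz d_nz; rewrite !is_gcd1P; split=> coP e /asboolP[ef eg].
  by apply/coP/asboolP; split; apply/divides_scale.
by apply/coP/asboolP; move: ef eg => /divides_scale ef /divides_scale eg; split; auto.
Qed.

Lemma mleadc1_nz p : mleadc p == 1 -> p != 0.
Proof. by apply: contraTneq => ->; rewrite mcoeff0 eq_sym oner_eq0. Qed.

Lemma mleadcMm p f : mleadc p == 1 -> mleadc (p * f) = mleadc f.
Proof.
move=> p1; have [->|f_nz] := eqVneq f 0; first by rewrite mulr0.
by rewrite mleadcM_proper (eqP p1) mul1r // mleadc_eq0.
Qed.

Lemma msizeMm d p f : mleadc p == 1 -> msize p = d.+1 -> f != 0 ->
  msize (p * f) = (d + msize f)%N.
Proof.
move=> p1 pd f_nz; have := msizeM (mleadc1_nz p1) f_nz => /= ->.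
by rewrite [X in (X + _)%N]pd.
Qed.

Lemma irreducible_msize p : irreducible p -> (1 < msize p)%N.
Proof.
by case=> p_nz; rewrite mpoly_unitE (mpolySpred mdeg p_nz) eqSS ltnS lt0n.
Qed.

(** The cofactor is a constant, and comparing leading coefficients makes it 1. *)
Lemma irreducible_divides_monic p q : irreducible p -> irreducible q ->
  mleadc p == 1 -> mleadc q == 1 -> divides q p -> p = q.
Proof.
move=> [p_nz _ p_irr] [q_nz q_nu _] p1 q1 [e pE].
have [|] := p_irr _ _ pE; last by rewrite (negPf q_nu).
rewrite mpoly_unitE => /msize_poly1P[c c_nz eE].
move: p1; rewrite pE eE mul_mpolyC mleadc_scale (eqP q1) mulr1 => /eqP->.
by rewrite scale1r.
Qed.

Lemma irreducible_divisor f : f != 0 -> f \isn't a GRing.unit ->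
  exists p, [/\ irreducible p, mleadc p == 1 & divides p f].
Proof.
move=> f_nz f_nu; have [u [s [Uu irr_s fE]]] := atomic_mpoly f_nz.
case: s => [|r s] in irr_s fE *; first by rewrite fE big_nil mulr1 Uu in f_nu.
have irr_r : irreducible r by apply: irr_s; rewrite mem_head.
have lc_nz : mleadc r != 0 by rewrite mleadc_eq0; case: irr_r.
exists ((mleadc r)^-1 *: r); split.
- by apply/irreducible_scale; rewrite ?invr_eq0.
- by rewrite mleadc_scale mulVf.
rewrite fE big_cons mulrCA; exists (mleadc r *: (u * \prod_(j <- s) j)).
by rewrite -scalerAl -scalerAr scalerA divff // scale1r mulrC.
Qed.

End Scalars.

Section Monics.
Variables (F : finFieldType) (k : nat).
Local Notation coeffs m := {ffun 'X_{1..k < m.+1} -> F}.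

Lemma mcoeff_poly_of m (a : coeffs m) (u : 'X_{1..k < m.+1}) : (poly_of a)@_u = a u.
Proof.
rewrite /poly_of raddf_sum /= (bigD1 u) //= big1 ?addr0 => [|v v_u].
  by rewrite mcoeffZ mcoeffX eqxx mulr1.
by rewrite mcoeffZ mcoeffX -bmeqP (negPf v_u) mulr0.
Qed.

Lemma poly_of_inj m : injective (@poly_of F k m).
Proof. by move=> a b eq_ab; apply/ffunP=> u; rewrite -!mcoeff_poly_of eq_ab. Qed.

Lemma poly_ofP m (p : {mpoly F[k]}) :
  (msize p <= m.+1)%N -> exists a : coeffs m, poly_of a = p.
Proof.
move=> p_le; exists [ffun u : 'X_{1..k < m.+1} => p@_u].
by rewrite [RHS](mpolywE p_le); apply: eq_bigr => u _; rewrite ffunE.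
Qed.

Definition monic_codes m : {set coeffs m} :=
  [set a in of_degree F k m | mleadc (poly_of a) == 1].

Definition scalar_class m (a : coeffs m) : {set coeffs m} :=
  [set b in of_degree F k m | scalar_eq a b].

Lemma scalar_classP m (a b : coeffs m) : a \in of_degree F k m ->
  reflect (exists2 c, c != 0 & poly_of b = c *: poly_of a) (b \in scalar_class a).
Proof.
rewrite !inE => a_deg; apply: (iffP idP) => [/andP[_ /existsP[c /andP[c_nz /eqP bE]]]|].
  by exists c.
case=> c c_nz bE; rewrite bE msize_scale // a_deg.
by apply/existsP; exists c; rewrite c_nz bE eqxx.
Qed.

(** Dividing by the leading coefficient puts a monic polynomial into each class; [scalar_class_inj]
    makes it unique, so classes are counted by their monic members. *)
Lemma normalizedE m : normalized F k m = [set scalar_class a | a in monic_codes m].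
Proof.
apply/setP=> X; apply/imsetP/imsetP=> [] [a]; last first.
  by rewrite inE => /andP[a_deg _] ->; exists a.
move=> a_deg ->; have := a_deg; rewrite inE => /eqP sz_a.
have a_nz : poly_of a != 0 by rewrite -msize_poly_eq0 sz_a.
have lc_nz : mleadc (poly_of a) != 0 by rewrite mleadc_eq0.
have [|b bE] := @poly_ofP m ((mleadc (poly_of a))^-1 *: poly_of a).
  by rewrite msize_scale ?invr_eq0 // sz_a.
have b_deg : b \in of_degree F k m by rewrite inE bE msize_scale ?invr_eq0 // sz_a.
exists b; first by rewrite inE b_deg bE mleadc_scale; apply/eqP; apply: mulVf.
apply/setP=> e; apply/scalar_classP/scalar_classP => // [] [c c_nz eE].
  exists (c * mleadc (poly_of a)); first by rewrite mulf_neq0.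
  by rewrite eE bE scalerA mulfK.
by exists (c / mleadc (poly_of a)); rewrite ?mulf_neq0 ?invr_eq0 // eE bE scalerA.
Qed.

Lemma scalar_class_inj m : {in monic_codes m &, injective (@scalar_class m)}.
Proof.
move=> a b; rewrite !inE => /andP[a_deg /eqP a1] /andP[b_deg /eqP b1] eq_ab.
have : a \in scalar_class b.
  by rewrite -eq_ab; apply/scalar_classP; [rewrite inE | exists 1; rewrite ?oner_eq0 ?scale1r].
case/scalar_classP; first by rewrite inE.
move=> c _ aE; apply: poly_of_inj; rewrite aE.
by move: a1; rewrite aE mleadc_scale b1 mulr1 => ->; rewrite scale1r.
Qed.

Lemma IkE m : Ik F k m = #|[set a in monic_codes m | `[< irreducible (poly_of a) >]]|.
Proof.
rewrite -(card_in_imset (f := @scalar_class m)); last first.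
  by move=> a b /[!inE] /andP[a_m _] /andP[b_m _]; apply: scalar_class_inj; rewrite !inE.
rewrite /Ik normalizedE; congr #|pred_of_set _|.
apply/setP=> X; apply/idP/imsetP => [|[a + ->]].
  rewrite inE => /andP[/imsetP[a a_m ->] /asboolP[b b_a irr_b]].
  exists a => //; rewrite inE a_m; apply/asboolP.
  move: a_m b_a; rewrite inE => /andP[a_deg _] /(scalar_classP _ a_deg)[c c_nz bE].
  by move: irr_b; rewrite bE => /irreducible_scale; apply.
move=> /setIdP[a_m /asboolP irr_a]; rewrite inE imset_f //=.
apply/asboolP; exists a => //; apply/scalar_classP; first by move: a_m; rewrite inE => /andP[].
by exists 1; rewrite ?oner_eq0 ?scale1r.
Qed.

Lemma PkE m n : Pk F k m n = #|[set ab in setX (monic_codes m) (monic_codes n) |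
  `[< is_gcd (poly_of ab.1) (poly_of ab.2) 1 >]]|.
Proof.
pose cl (ab : coeffs m * coeffs n) := (scalar_class ab.1, scalar_class ab.2).
have self j (a : coeffs j) : a \in monic_codes j -> a \in scalar_class a.
  rewrite inE => /andP[a_deg _]; apply/scalar_classP => //.
  by exists 1; rewrite ?oner_eq0 ?scale1r.
rewrite -(card_in_imset (f := cl)); last first.
  move=> [a b] [a' b'] /setIdP[/setXP[/= a_m b_m] _] /setIdP[/setXP[/= a'_m b'_m] _].
  move=> eq_cl; have := scalar_class_inj a_m a'_m (congr1 fst eq_cl).
  by have := scalar_class_inj b_m b'_m (congr1 snd eq_cl) => -> ->.
rewrite /Pk !normalizedE; congr #|pred_of_set _|.
apply/setP=> -[X Y]; apply/idP/imsetP => [|[[a b]]].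
  move=> /setIdP[/setXP[/imsetP[a a_m ->] /imsetP[b b_m ->]]].
  move=> /asboolP[a' [b' [/= a'_a b'_b co]]]; exists (a, b) => //.
  have [[/setIdP[a_deg _] /setIdP[b_deg _]]] := (a_m, b_m).
  rewrite inE in_setX a_m b_m /=; apply/asboolP.
  have [c c_nz a'E] := scalar_classP _ a_deg a'_a.
  have [d d_nz b'E] := scalar_classP _ b_deg b'_b.
  by move: co; rewrite a'E b'E => /is_gcd1_scale; apply.
move=> /setIdP[/setXP[/= a_m b_m] /asboolP co] [-> ->].
rewrite inE in_setX /= !imset_f //=.
by apply/asboolP; exists a, b; split=> //; apply: self.
Qed.

(** Codes of different degrees have different types; as sequences of polynomials the monic elements
    of all degrees share one type, in which the sieve can multiply them. *)
Definition monics m : seq {mpoly F[k]} := [seq poly_of a | a in monic_codes m].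

Lemma monics_uniq m : uniq (monics m).
Proof. by rewrite map_inj_uniq ?enum_uniq //; apply: poly_of_inj. Qed.

Lemma mem_monics m p : (p \in monics m) = (mleadc p == 1) && (msize p == m.+1).
Proof.
apply/imageP/andP=> [[a + ->]|[p1 /eqP pm]]; first by rewrite !inE => /andP[].
have [|a aE] := @poly_ofP m p; first by rewrite pm.
by exists a; rewrite ?inE ?aE // p1 pm eqxx.
Qed.

Lemma count_image (T : finType) (U : eqType) (h : T -> U) (A : {set T}) (P : pred U) :
  count P [seq h a | a in A] = #|[set a in A | P (h a)]|.
Proof.
rewrite count_map cardE -size_filter /enum_mem -filter_predI.
by congr (size _); apply: eq_filter => a; rewrite !inE andbC.
Qed.

Lemma Nk_monics m : Nk F k m%:Z = size (monics m).
Proof.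
rewrite /= normalizedE card_in_imset; last exact: scalar_class_inj.
by rewrite size_map cardE.
Qed.

Lemma Ik_monics m : Ik F k m = count (fun p => `[< irreducible p >]) (monics m).
Proof. by rewrite IkE count_image. Qed.

Definition monic_pairs m n : seq ({mpoly F[k]} * {mpoly F[k]}) :=
  [seq (f, g) | f <- monics m, g <- monics n].

Lemma Pk_monic_pairs m n :
  Pk F k m n = count (fun fg => `[< is_gcd fg.1 fg.2 1 >]) (monic_pairs m n).
Proof.
rewrite PkE -(count_image (fun ab => (poly_of ab.1, poly_of ab.2))
  (setX (monic_codes m) (monic_codes n)) (fun fg => `[< is_gcd fg.1 fg.2 1 >])).
apply/permP/uniq_perm.
- rewrite map_inj_uniq ?enum_uniq // => -[a b] [a' b'] [/poly_of_inj-> /poly_of_inj->] //.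
- by rewrite allpairs_uniq ?monics_uniq // => -[? ?] [? ?] _ _ [-> ->].
move=> [f g]; apply/imageP/allpairsP => [[[a b] + [-> ->]]|[[f' g'] [/imageP[a a_m ->]]]].
  by rewrite in_setX => /andP[/= a_m b_m]; exists (poly_of a, poly_of b); rewrite !image_f.
by move=> /imageP[b b_m ->] [-> ->]; exists (a, b); rewrite // in_setX a_m.
Qed.

End Monics.

(** * The sieve *)

(** The coefficient of degree [n] in the product of the generating series of [A] and [B]. *)
Definition convolution (A B : nat -> int) (n : nat) : int :=
  \sum_(d < n.+1) A d * B (n - d)%N.

Lemma convolution_1subXn (P : {poly int}) (B : nat -> int) e n :
  convolution (nth 0 ((1 - 'X^e) * P)) B n =
    convolution (nth 0 P) B n - (if (e <= n)%N then convolution (nth 0 P) B (n - e)%N else 0).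
Proof.
rewrite /convolution mulrBl mul1r.
under eq_bigr => d _ do rewrite coefB coefXnM mulrBl.
rewrite sumrB; congr (_ - _).
case: leqP => [e_n|n_e]; last first.
  by rewrite big1 // => d _; rewrite (leq_trans (ltn_ord d)) ?mul0r.
rewrite -(big_mkord xpredT (fun d => (if (d < e)%N then 0 else P`_(d - e)) * B (n - d)%N)).
rewrite (big_cat_nat (n := e)) //=; last by rewrite ltnW.
rewrite big_nat big1 ?add0r => [|d /andP[_ ->]]; last by rewrite mul0r.
rewrite -{1}[e]add0n big_addn subSn // big_mkord; apply: eq_bigr => d _.
by rewrite ltnNge leq_addl addnK [(d + e)%N]addnC subnDA.
Qed.

Section Sieve.
Variables (F : finFieldType) (k : nat).
Implicit Types (p q : {mpoly F[k]}) (s : seq {mpoly F[k]}).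

(** For nonzero [p], [(msize p).-1] is the total degree, so this is a partial Euler product of the
    inverse zeta function. *)
Definition sieve_poly s : {poly int} := \prod_(p <- s) (1 - 'X^((msize p).-1)).

Definition free_of s (fg : {mpoly F[k]} * {mpoly F[k]}) : bool :=
  all (fun p => ~~ common_divisor p fg) s.

Definition scale_pair p (fg : {mpoly F[k]} * {mpoly F[k]}) := (p * fg.1, p * fg.2).

(** Each [q] in [s] is prime and does not divide [p], so it divides [p * f] only if it divides
    [f]. *)
Lemma free_of_scale_pair p s fg : irreducible p -> mleadc p == 1 ->
    p \notin s -> (forall q, q \in s -> irreducible q /\ mleadc q == 1) ->
  free_of s (scale_pair p fg) = free_of s fg.
Proof.
move=> irr_p p1 p_s sP; apply: eq_in_all => q q_s; congr (~~ _).
have [irr_q q1] := sP q q_s; apply/asboolP/asboolP => /=.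
  have cancel f : divides q (p * f) -> divides q f.
    case/(irreducibles_prime_mpoly irr_q) => // q_p.
    by move: p_s; rewrite (irreducible_divides_monic irr_p irr_q p1 q1 q_p) q_s.
  by case=> /cancel ? /cancel.
by case; split; apply: divides_mull.
Qed.

(** [M] stays abstract because two families are sieved: pairs of monic polynomials and pairs
    [(f, 0)]. The second hypothesis makes multiplication by a monic [p] of degree [e] a bijection
    from [M (i - e)] onto the pairs of multiples of [p] in [M i]. *)
Lemma sieve (M : nat -> seq ({mpoly F[k]} * {mpoly F[k]})) s n :
    (forall i, uniq (M i)) ->
    (forall p e i fg, mleadc p == 1 -> msize p = e.+1 ->
       (scale_pair p fg \in M i) = (e <= i)%N && (fg \in M (i - e)%N)) ->
    uniq s -> (forall p, p \in s -> irreducible p /\ mleadc p == 1) ->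
  (count (free_of s) (M n))%:Z =
    convolution (nth 0 (sieve_poly s)) (fun i => (size (M i))%:Z) n.
Proof.
move=> uniqM shiftM; elim: s => [|p s IHs] in n *.
  move=> _ _; rewrite /convolution /sieve_poly big_nil big_ord_recl coef1 mul1r subn0.
  rewrite big1 ?addr0 => [|i _]; last by rewrite coef1 mul0r.
  by congr Posz; apply/eqP; rewrite -all_count; apply/allP.
rewrite cons_uniq => /andP[p_s uniq_s] sP.
have [irr_p p1] := sP p (mem_head p s).
have sP' q : q \in s -> irreducible q /\ mleadc q == 1.
  by move=> q_s; apply: sP; rewrite inE q_s orbT.
have [e pe] : exists e, msize p = e.+1.
  by exists (msize p).-1; rewrite -mpolySpred; case: irr_p.
have p_nz : p != 0 by case: irr_p.
rewrite /sieve_poly big_cons pe convolution_1subXn -/(sieve_poly s) -!IHs //.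
(* [D] holds the pairs that survive [s]; those that [p] removes are [p] times the survivors in
   degree [n - e], collected below in [D']. *)
pose D := filter (free_of s) (M n).
have -> : count (free_of (p :: s)) (M n) = count (predC (common_divisor p)) D.
  by rewrite count_filter; apply: eq_count.
have -> : count (free_of s) (M n) = size D by rewrite size_filter.
rewrite -(count_predC (common_divisor p) D) PoszD.
suff -> : (if (e <= n)%N then (count (free_of s) (M (n - e)%N))%:Z else 0)
    = (count (common_divisor p) D)%:Z by rewrite addrAC subrr add0r.
pose D' := if (e <= n)%N then [seq scale_pair p fg | fg <- M (n - e)%N & free_of s fg] else [::].
have -> : count (common_divisor p) D = size D'.
  rewrite -size_filter; apply/perm_size/uniq_perm; first by rewrite !filter_uniq.
    rewrite /D'; case: ifP => // _; rewrite map_inj_uniq ?filter_uniq // => -[f g] [f' g'].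
    move=> eq_s; have /= := mulfI p_nz (congr1 fst eq_s).
    by have /= := mulfI p_nz (congr1 snd eq_s) => -> ->.
  move=> fg; rewrite !mem_filter /D'; apply/and3P/idP => [[p_fg s_fg M_fg]|].
    have [[f fE] [g gE]] := asboolW p_fg.
    have fgE : fg = scale_pair p (f, g).
      by rewrite [fg]surjective_pairing fE gE /scale_pair ![p * _]mulrC.
    move: M_fg s_fg; rewrite fgE (shiftM p e) // => /andP[-> M_fg].
    rewrite free_of_scale_pair // => s_fg.
    by apply: map_f; rewrite mem_filter s_fg.
  case: ifP => // e_n /mapP[fg']; rewrite mem_filter => /andP[s_fg' M_fg'] ->.
  rewrite free_of_scale_pair // (shiftM p e) // e_n; split=> //.
  by apply/asboolP; split; [exists fg'.1 | exists fg'.2]; rewrite mulrC.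
by rewrite /D'; case: ifP => // _; rewrite size_map size_filter.
Qed.

End Sieve.

(** * Coefficients of the Euler product *)

Section EulerProduct.
Variable R : comNzRingType.
Implicit Types (P Q : {poly R}) (c : nat -> nat).

(** Congruence modulo ['X^(n.+1)]. *)
Definition eq_upto n P Q := forall j, (j <= n)%N -> P`_j = Q`_j.

Lemma eq_upto_mul n P P' Q Q' :
  eq_upto n P P' -> eq_upto n Q Q' -> eq_upto n (P * Q) (P' * Q').
Proof.
move=> eqP eqQ j j_n; rewrite !coefM; apply: eq_bigr => i _.
rewrite eqP ?eqQ // (leq_trans _ j_n) ?leq_subr // -ltnS.
exact: ltn_ord.
Qed.

Lemma eq_upto_prod n (I : finType) (P Q : I -> {poly R}) :
  (forall i, eq_upto n (P i) (Q i)) -> eq_upto n (\prod_i P i) (\prod_i Q i).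
Proof. by move=> eqPQ; apply: (big_ind2 (eq_upto n)) => // *; apply: eq_upto_mul. Qed.

Lemma sum_ord_widen (g : nat -> R) m n : (m <= n)%N ->
  (forall a, (m < a)%N -> g a = 0) -> \sum_(a < n.+1) g a = \sum_(a < m.+1) g a.
Proof.
move=> m_n g0; rewrite -!(big_mkord xpredT g) (big_cat_nat (n := m.+1)) //=.
by rewrite [X in _ + X]big_nat [X in _ + X]big1 ?addr0 // => a /andP[/g0].
Qed.

(** The binomial theorem with a range independent of [c]: terms with [a > c] have coefficient zero,
    terms with [a > d] have degree above [d]. *)
Lemma eq_upto_1subXn_exp (c i d : nat) : eq_upto d ((1 - 'X^(i.+1)) ^+ c)
  (\sum_(a < d.+1) ((-1) ^+ a *+ 'C(c, a)) *: 'X^(i.+1 * a)).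
Proof.
move=> j j_d; rewrite exprBn !coef_sum.
pose g a : R := ((-1) ^+ a *+ 'C(c, a)) * (j == i.+1 * a)%N%:R.
transitivity (\sum_(a < c.+1) g a).
  apply: eq_bigr => a _; rewrite expr1n mulr1 -exprM -signr_odd coefMn /g.
  rewrite -[in RHS]signr_odd mulrnAl; congr (_ *+ _); case: (odd a).
    by rewrite !expr1 !mulN1r coefN coefXn.
  by rewrite !expr0 !mul1r coefXn.
transitivity (\sum_(a < d.+1) g a); last first.
  by apply: eq_bigr => a _; rewrite coefZ coefXn.
rewrite -(@sum_ord_widen g c (maxn c d)) ?leq_maxl // => [|a c_a]; last first.
  by rewrite /g bin_small // mulr0n mul0r.
rewrite -(@sum_ord_widen g d (maxn c d)) ?leq_maxr // => a d_a.
rewrite /g ltn_eqF ?mulr0 //.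
by rewrite (leq_ltn_trans j_d) // (leq_trans d_a) // mulSn leq_addr.
Qed.

(** Factors with [i >= d] are 1 up to degree [d] and drop out. Distributing the product of the
    remaining binomial expansions gives one term per choice of the exponents [a i]. *)
Lemma coef_Euler_product c d D : (d <= D)%N ->
  (\prod_(i < D) (1 - 'X^(i.+1) : {poly R}) ^+ c i.+1)`_d =
  \sum_(a : {ffun 'I_d -> 'I_d.+1} | (\sum_(i < d) i.+1 * a i == d)%N)
     (-1) ^+ (\sum_(i < d) a i)%N * \prod_(i < d) ('C(c i.+1, a i))%:R.
Proof.
move=> d_D; transitivity (\prod_(i < d) (1 - 'X^(i.+1) : {poly R}) ^+ c i.+1)`_d.
  rewrite -(subnKC d_D); elim: (D - d)%N => [|r IHr]; first by rewrite addn0.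
  rewrite addnS big_ord_recr /= -IHr -[in RHS](mulr1 (\prod_(i < d + r) _)).
  apply: (@eq_upto_mul d) => // j j_d.
  have d_lt : (j < (d + r).+1)%N by rewrite ltnS (leq_trans j_d) ?leq_addr.
  elim: (c _) => [|e IHe]; first by rewrite expr0.
  rewrite exprS mulrBl mul1r coefB IHe.
  by rewrite coefXnM d_lt subr0.
rewrite (eq_upto_prod (fun i : 'I_d => @eq_upto_1subXn_exp (c i.+1) i d)) //.
rewrite bigA_distr_bigA coef_sum /= [RHS]big_mkcond /=; apply: eq_bigr => a _.
under eq_bigr do rewrite -mul_polyC.
rewrite big_split /= -rmorph_prod mul_polyC coefZ.
rewrite -(big_morph (fun n => 'X^n) (id1 := 1) (op1 := *%R) (exprD 'X) (expr0 'X)) coefXn.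
rewrite eq_sym; case: eqP => _; rewrite ?mulr0 // mulr1.
rewrite expr_sum -big_split; apply: eq_bigr => i _ /=.
by rewrite mulr_natr.
Qed.

End EulerProduct.

(** * Exact formulas *)

Section ExactFormulas.
Variables (F : finFieldType) (k : nat).
Implicit Types (p f g : {mpoly F[k]}).

Definition irreducible_monics m : seq {mpoly F[k]} :=
  [seq p <- monics F k m | `[< irreducible p >]].

Fixpoint irreducible_monics_upto m : seq {mpoly F[k]} :=
  if m is m'.+1 then irreducible_monics m ++ irreducible_monics_upto m' else [::].

Lemma mem_irreducible_monics_upto m p : (p \in irreducible_monics_upto m) =
  [&& mleadc p == 1, (msize p <= m.+1)%N & `[< irreducible p >]].
Proof.
elim: m => [|m IHm] /=.
  by case: asboolP; rewrite ?andbF // => /irreducible_msize; case: leqP; rewrite ?andbF.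
rewrite mem_cat mem_filter mem_monics IHm [in RHS]leq_eqVlt ltnS.
by case: (mleadc p == 1); case: `[< _ >]; rewrite ?andbF ?orbF ?andbT ?andTb.
Qed.

Lemma irreducible_monics_upto_uniq m : uniq (irreducible_monics_upto m).
Proof.
elim: m => //= m IHm; rewrite cat_uniq IHm filter_uniq ?monics_uniq // andbT.
apply/hasPn=> p; rewrite mem_irreducible_monics_upto mem_filter mem_monics => /and3P[_ p_m _].
by rewrite (ltn_eqF (_ : _ < _)%N) ?andbF.
Qed.

Lemma sieve_poly_irreducible_monics_upto m :
  sieve_poly (irreducible_monics_upto m) = \prod_(i < m) (1 - 'X^(i.+1)) ^+ Ik F k i.+1.
Proof.
elim: m => [|m IHm]; first by rewrite /sieve_poly big_nil big_ord0.
rewrite big_ord_recr /= -IHm mulrC /sieve_poly big_cat /=; congr (_ * _).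
rewrite Ik_monics -size_filter -/(irreducible_monics m.+1).
rewrite (eq_big_seq (fun=> 1 - 'X^(m.+1))) => [|p]; last first.
  by rewrite mem_filter mem_monics => /and3P[_ _ /eqP->].
by rewrite big_const_seq count_predT iter_mulr_1.
Qed.

Lemma coef_sieve_poly m d : (d <= m)%N ->
  (sieve_poly (irreducible_monics_upto m))`_d = Ak F k d.
Proof.
move=> d_m; rewrite sieve_poly_irreducible_monics_upto (coef_Euler_product _ (Ik F k)) //.
by apply: eq_bigr => a _; congr (_ * _); apply: eq_bigr => i _; rewrite natz.
Qed.

Lemma divides_msize p f : f != 0 -> divides p f -> (msize p <= msize f)%N.
Proof.
move=> f_nz [e fE]; move: f_nz; rewrite fE mulf_eq0 negb_or => /andP[e_nz p_nz].
have := msizeM e_nz p_nz => /= ->; have := mpolySpred mdeg e_nz => /= ->.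
by rewrite addSn /= leq_addl.
Qed.

(** A nonunit common divisor has a monic irreducible divisor, of degree at most [n] because it
    divides a nonzero member of degree [n]. One such member suffices, which admits unequal degrees
    and pairs [(f, 0)]. *)
Lemma free_of_units n f g : (f != 0) && (msize f == n.+1) || (g != 0) && (msize g == n.+1) ->
  free_of (irreducible_monics_upto n) (f, g) =
    `[< forall e, common_divisor e (f, g) -> e \is a GRing.unit >].
Proof.
move=> fg_n; apply/allP/asboolP => [free e e_fg|unit_fg p].
  apply: contraT => e_nu.
  have e_nz : e != 0.
    apply: contraTneq e_fg => ->; apply/asboolP => -[[f' f0] [g' g0]].
    by move: fg_n; rewrite [f]f0 [g]g0 !mulr0 eqxx.
  have [p [irr_p p1 pe]] := irreducible_divisor e_nz e_nu.
  have [/= ef eg] := asboolW e_fg.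
  have [pf pg] := (divides_trans pe ef, divides_trans pe eg).
  suff /free : p \in irreducible_monics_upto n.
    by move=> /negP[]; apply/asboolP.
  rewrite mem_irreducible_monics_upto p1 asboolT // andbT.
  by case/orP: fg_n => /andP[nz /eqP <-]; apply: divides_msize.
rewrite mem_irreducible_monics_upto => /and3P[_ _ /asboolP irr_p].
by apply/negP => /unit_fg; apply/negP; case: irr_p.
Qed.

Lemma mem_monicsM p f e m : mleadc p == 1 -> msize p = e.+1 ->
  (p * f \in monics F k m) = (e <= m)%N && (f \in monics F k (m - e)).
Proof.
move=> p1 pe; rewrite !mem_monics mleadcMm //.
have [f1|] := boolP (mleadc f == 1); last by rewrite andbF.
rewrite (msizeMm p1 pe) ?mleadc1_nz //=.
have /mpolySpred -> := mleadc1_nz f1; lia.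
Qed.

Lemma mem_monic_pairs m n f g :
  ((f, g) \in monic_pairs F k m n) = (f \in monics F k m) && (g \in monics F k n).
Proof.
apply/allpairsP/andP => [[[f' g'] /= [f_m g_n [-> ->]]]|[f_m g_n]] //.
by exists (f, g).
Qed.

(* The sieve applied to the pairs (f, 0), whose common divisors are the
   divisors of f. *)
Lemma Ak_Nk_inverse n :
  convolution (Ak F k) (fun i => (Nk F k i)%:Z) n = (n == 0%N)%:R.
Proof.
pose M i : seq ({mpoly F[k]} * {mpoly F[k]}) := [seq (f, 0) | f <- monics F k i].
have memM i f g : ((f, g) \in M i) = (f \in monics F k i) && (g == 0).
  apply/mapP/andP => [[f' f_i [-> ->]]|[f_i /eqP->]]; first by rewrite eqxx.
  by exists f.
transitivity (convolution (nth 0 (sieve_poly (irreducible_monics_upto n)))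
    (fun i => (size (M i))%:Z) n).
  apply: eq_bigr => d _; rewrite (coef_sieve_poly (ltn_ord d : (d <= n)%N)).
  by rewrite [in LHS]Nk_monics [in RHS]size_map.
rewrite -sieve ?irreducible_monics_upto_uniq //; last 3 first.
- by move=> i; rewrite map_inj_uniq ?monics_uniq // => f g [].
- move=> p e i [f g] p1 pe; rewrite /scale_pair /= !memM (mem_monicsM _ _ p1 pe).
  by rewrite mulf_eq0 (negPf (mleadc1_nz p1)) andbA.
- by move=> p; rewrite mem_irreducible_monics_upto => /and3P[-> _ /asboolP].
(* A surviving [(f, 0)] has [f] a unit, so survivors occur in degree 0 only, where 1 is the single
   monic polynomial. *)
have -> : count (free_of (irreducible_monics_upto n)) (M n) =
    count (fun=> n == 0%N) (M n).
  apply: eq_in_count => -[f g]; rewrite memM mem_monics => /andP[/andP[f1 fn] /eqP->].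
  rewrite (@free_of_units n) ?fn ?(mleadc1_nz f1) //.
  apply/asboolP/idP => [unit_f|n0 e /asboolP[/= ef _]].
    have : f \is a GRing.unit.
      by apply/unit_f/asboolP; split; [exact: divides_refl | exists 0; rewrite mul0r].
    by rewrite mpoly_unitE (eqP fn).
  by apply: unit_divides ef; rewrite mpoly_unitE (eqP fn) (eqP n0).
case: eqP => [->|_]; last by rewrite count_pred0.
rewrite count_predT size_map.
have /perm_size -> // : perm_eq (monics F k 0) [:: 1].
apply: uniq_perm; rewrite ?monics_uniq // => f.
rewrite mem_monics inE; apply/andP/eqP => [[f1 /msize_poly1P[c c_nz fE]]|->].
  by move: f1; rewrite fE mleadcC => /eqP->.
by rewrite mleadc1 msize1 !eqxx.
Qed.

(** Here [n] is the smaller degree and [u], [v] are the excesses. As one excess is zero, a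
    polynomial of degree above [i] cannot divide both members of a pair in [M i], as the sieve
    requires. *)
Lemma Pk_convolution u v n : (u == 0%N) || (v == 0%N) ->
  (Pk F k (n + u) (n + v))%:Z =
    convolution (Ak F k) (fun i => (Nk F k (i + u)%N)%:Z * (Nk F k (i + v)%N)%:Z) n.
Proof.
move=> uv; pose M i := monic_pairs F k (i + u) (i + v).
transitivity (convolution (nth 0 (sieve_poly (irreducible_monics_upto n)))
    (fun i => (size (M i))%:Z) n); last first.
  apply: eq_bigr => d _; rewrite (coef_sieve_poly (ltn_ord d : (d <= n)%N)).
  by rewrite /= /M /monic_pairs size_allpairs PoszM -!Nk_monics.
rewrite -sieve ?irreducible_monics_upto_uniq //; last 3 first.
- by move=> i; rewrite allpairs_uniq ?monics_uniq // => -[f g] [f' g'] _ _ /= [-> ->].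
- move=> p e i [f g] p1 pe; rewrite /scale_pair /= !mem_monic_pairs !(mem_monicsM _ _ p1 pe).
  have [e_i|i_e] := boolP (e <= i)%N.
    by rewrite !(leq_trans e_i) ?leq_addr // !addnBAC.
  by case/orP: uv => /eqP->; rewrite addn0 (negPf i_e) ?andbF.
- by move=> p; rewrite mem_irreducible_monics_upto => /and3P[-> _ /asboolP].
rewrite Pk_monic_pairs; congr Posz; apply: eq_in_count => -[f g].
rewrite mem_monic_pairs !mem_monics => /andP[/andP[f1 fn] /andP[g1 gn]].
rewrite free_of_units; last first.
  rewrite (mleadc1_nz f1) (mleadc1_nz g1) (eqP fn) (eqP gn) /=.
  by case/orP: uv => /eqP->; rewrite addn0 eqxx ?orbT.
by apply/asboolP/asboolP => /is_gcd1P.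
Qed.

End ExactFormulas.

(** * Growth *)

Section Growth.
Local Open Scope nat_scope.

Definition nb_monomials k m := 'C(m + k, k).
Local Notation b := nb_monomials.

Lemma nb_monomialsSS k m : b k.+1 m.+1 = b k.+1 m + b k m.+1.
Proof. by rewrite /nb_monomials !addSn !addnS binS. Qed.

Lemma nb_monomials0 k : b k 0 = 1.
Proof. by rewrite /nb_monomials binn. Qed.

Lemma nb_monomials_gt0 k m : 0 < b k m.
Proof. by rewrite bin_gt0 leq_addl. Qed.

Lemma leq_nb_monomials k m n : m <= n -> b k m <= b k n.
Proof. by move=> m_n; apply: leq_bin2l; rewrite leq_add2r. Qed.

(** By Pascal's rule, raising [y] by one adds no more on the left than on the right. The extra 1 is
    the value at [y = 0]. *)
Lemma nb_monomials_superadditive k x y : b k x + b k y <= (b k (x + y)).+1.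
Proof.
elim: k y => [|k IHk] y; first by rewrite /nb_monomials !bin0.
elim: y => [|y IHy]; first by rewrite nb_monomials0 addn0 addn1.
rewrite addnS !nb_monomialsSS addnA -addSn leq_add //.
by apply: leq_nb_monomials; rewrite ltnS leq_addl.
Qed.

(** Summing the hypothesis over [e] by Pascal's rule turns the constant slack [c] into the linear
    slack [c * e]; [K] absorbs the range below [E]. *)
Lemma nb_monomials_growth_step k T c E :
    (forall e, E <= e -> b k (e + T) + c <= 2 * b k e) ->
  exists K, forall e, b k.+1 (e + T) + c * e <= 2 * b k.+1 e + K.
Proof.
move=> growth; exists (b k.+1 (E + T) + c * E).
elim=> [|e IHe].
  by have := @leq_nb_monomials k.+1 (0 + T) (E + T); lia.
have [e_E|E_e] := leqP e.+1 E.
  have := @leq_nb_monomials k.+1 (e.+1 + T) (E + T).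
  have : c * e.+1 <= c * E by rewrite leq_mul2l e_E orbT.
  by lia.
have := growth e.+1 (ltnW E_e); rewrite addSn !nb_monomialsSS mulnS.
by lia.
Qed.

(** In one variable [b] is linear with slope 1, and doubling wins. For the step, the linear slack of
    the previous lemma exceeds [K + c] eventually. *)
Lemma nb_monomials_growth k T c :
  exists E, forall e, E <= e -> b k.+1 (e + T) + c <= 2 * b k.+1 e.
Proof.
elim: k c => [|k IHk] c.
  by exists (T + c) => e; rewrite /nb_monomials !bin1; lia.
have [E /nb_monomials_growth_step[K linear]] := IHk 1.
by exists (K + c) => e; have := linear e; lia.
Qed.

(* This is where k >= 2 is needed: for k = 1 the left-hand side exceeds the
   right-hand side by about (c - 1) e. *)
Lemma nb_monomials_linear k T c : 1 < k ->
  exists K, forall e, b k (e + T) + c * e <= 2 * b k e + K.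
Proof.
case: k => [|[|k]] // _.
by have [E /nb_monomials_growth_step] := nb_monomials_growth k T c.
Qed.

Lemma sum_geometric_le q n : 1 < q -> \sum_(d < n) q ^ (2 * d).+1 <= q ^ (2 * n).
Proof.
move=> q_gt1; elim: n => [|n IHn]; first by rewrite big_ord0.
rewrite big_ord_recr /= mulnS addnC !addSn add0n !expnS.
rewrite (leq_trans (leq_add (leqnn _) IHn)) //; move: (q ^ (2 * n)) => z; nia.
Qed.

Lemma sum_dominated_le (X : nat -> nat) Y n :
  (forall e, e < n -> X e * 2 ^ e <= Y) -> \sum_(e < n) X e <= 2 * Y.
Proof.
(* The bound [2 Y (1 - 2 ^ - n)], cleared of denominators, is strong enough for induction. *)
move=> X_le; suff : (\sum_(e < n) X e) * 2 ^ n + 2 * Y <= 2 * Y * 2 ^ n.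
  move=> le_n; rewrite -(@leq_pmul2r (2 ^ n)) ?expn_gt0 //.
  by apply: leq_trans le_n; rewrite leq_addr.
elim: n X_le => [|n IHn] X_le; first by rewrite big_ord0 !muln1.
have := IHn (fun e e_n => X_le e (leqW e_n)); have := X_le n (ltnSn n).
rewrite big_ord_recr /= expnS; move: (\sum_(i < n) X i) (2 ^ n) (X n) => S z x.
by nia.
Qed.

End Growth.

(** * Bounds on the number of normalized polynomials *)

Section Bounds.
Variables (F : finFieldType) (k : nat).
Local Notation coeffs m := {ffun 'X_{1..k < m.+1} -> F}.
Local Notation q := #|F|.
Local Notation b := (nb_monomials k).

(** Each exponent is at most the degree, so monomials correspond to the tuples over ['I_m.+1] with
    sum at most [m]. *)
Lemma card_bmultinom m : #|{: 'X_{1..k < m.+1}}| = b m.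
Proof.
rewrite /nb_monomials addnC -card_partial_ord_partitions.
pose f (u : 'X_{1..k < m.+1}) : k.-tuple 'I_m.+1 := [tuple inord (u i) | i < k].
have le_deg (u : 'X_{1..k}) i : (u i <= mdeg u)%N.
  by rewrite mdegE (bigD1 i) //= leq_addr.
have fE (u : 'X_{1..k < m.+1}) i : tnth (f u) i = u i :> nat.
  by rewrite tnth_mktuple inordK // (leq_ltn_trans (le_deg _ _)) // bmdeg.
rewrite -(card_imset (f := f)) => [|u v eq_uv]; last first.
  by apply/val_inj/mnmP=> i; rewrite -!fE eq_uv.
apply: eq_card => t; rewrite inE; apply/imsetP/idP => [[u _ ->]|t_m].
  rewrite big_tuple (eq_bigr (fun i => u i)) => [|i _]; last by rewrite fE.
  by rewrite -mdegE -ltnS bmdeg.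
have t_deg : (mdeg [multinom (tnth t i : nat) | i < k] < m.+1)%N.
  rewrite mdegE ltnS; move: t_m; rewrite big_tuple.
  by under [X in _ -> (X <= _)%N]eq_bigr do rewrite mnmE.
exists (BMultinom t_deg) => //; apply/eq_from_tnth => i.
by apply: val_inj; rewrite /= fE mnmE.
Qed.

Lemma Nk_le (m : nat) : (Nk F k m <= q ^ b m)%N.
Proof.
rewrite Nk_monics size_map -cardE (leq_trans (max_card _)) //.
by rewrite card_ffun card_bmultinom.
Qed.

Lemma msize_poly_of m (a : coeffs m) : (msize (poly_of a) <= m.+1)%N.
Proof.
apply: leq_trans (mmeasure_sum _ _ _ _) _; apply/bigmax_leqP => u _.
by apply: leq_trans (msizeZ_le _ _) _; rewrite msizeX bmdeg.
Qed.

(* Polynomials whose coefficient at x_0 ^ m is 1 have degree m and are pairwise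
   inequivalent. *)
Lemma Nk_ge (m : nat) : (0 < k)%N -> (q ^ (b m).-1 <= Nk F k m)%N.
Proof.
move=> k_gt0; pose x0 := Ordinal k_gt0.
have u0_deg : (mdeg (U_(x0) *+ m)%MM < m.+1)%N by rewrite mdegMn mdeg1 mul1n.
pose u0 : 'X_{1..k < m.+1} := BMultinom u0_deg.
pose S := [set a : coeffs m | a u0 == 1].
have S_deg a : a \in S -> a \in of_degree F k m.
  rewrite !inE => /eqP a1; rewrite eqn_leq msize_poly_of /=.
  have : (u0 : 'X_{1..k}) \in msupp (poly_of a) by rewrite mcoeff_msupp mcoeff_poly_of a1 oner_eq0.
  by move=> /msize_mdeg_lt /=; rewrite mdegMn mdeg1 mul1n.
have <- : #|S| = (q ^ (b m).-1)%N.
  pose R (u : 'X_{1..k < m.+1}) := if u == u0 then pred1 (1 : F) else predT.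
  transitivity #|family R|.
    apply: eq_card => a; rewrite inE; apply/eqP/familyP => [a1 u|/(_ u0)].
      by rewrite /R; case: eqP => [->|_]; rewrite inE // a1.
    by rewrite /R eqxx inE => /eqP.
  rewrite card_family foldrE big_image (bigD1 u0) //= /R eqxx card1 mul1n.
  rewrite (eq_bigr (fun=> q)) => [|u /negPf->]; last by rewrite -cardsT; apply: eq_card.
  by rewrite prod_nat_const -card_bmultinom -(cardC1 u0).
rewrite /= -(card_in_imset (f := @scalar_class F k m)) => [|a a' a_S a'_S eq_cl]; last first.
  have : a \in scalar_class a'.
    rewrite -eq_cl; apply/scalar_classP; first exact: S_deg.
    by exists 1; rewrite ?oner_eq0 ?scale1r.
  case/(scalar_classP _ (S_deg _ a'_S)) => c _ aE; apply: poly_of_inj; rewrite aE.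
  have := mcoeff_poly_of a u0; rewrite aE mcoeffZ mcoeff_poly_of.
  by move: a_S a'_S; rewrite !inE => /eqP-> /eqP->; rewrite mulr1 => ->; rewrite scale1r.
apply: subset_leq_card; apply/subsetP => X /imsetP[a a_S ->].
by apply/imsetP; exists a => //; apply: S_deg.
Qed.

End Bounds.

(** * The error term *)

#[local] Arguments Nk : simpl never.

Section Tail.
Variables (F : finFieldType) (k : nat).
Local Notation q := #|F|.
Local Notation b := (nb_monomials k).

Lemma absz_sum_le (I : finType) (f : I -> int) : (`|(\sum_i f i)%R| <= \sum_i `|f i|)%N.
Proof. by elim/big_rec2: _ => // i x y _; lia. Qed.

Lemma abs_Ak0_Nk0 : `|Ak F k 0|%N = 1%N /\ Nk F k 0 = 1%N.
Proof.
have := Ak_Nk_inverse F k 0; rewrite /convolution big_ord_recl big_ord0 addr0 /=.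
by move/(congr1 absz); rewrite abszM => /eqP; rewrite muln_eq1 => /andP[/eqP-> /eqP].
Qed.

(** Strong induction through the inverse relation, which expresses [A(n)] by the products
    [A(d) N(n - d)] with [d < n]. Superadditivity bounds each, times [q], by [q ^ (2 d + 1 + b n)],
    and the geometric sum closes the induction. *)
Lemma Ak_le n : (`|Ak F k n| * q <= q ^ (2 * n + b n))%N.
Proof.
have q_gt1 : (1 < q)%N by apply: card_finNzRing_gt1.
have [A0 N0] := abs_Ak0_Nk0.
elim/ltn_ind: n => -[_|n IHn]; first by rewrite A0 nb_monomials0 mul1n.
have /eqP := Ak_Nk_inverse F k n.+1; rewrite /convolution big_ord_recr /= subnn.
rewrite addrC addr_eq0 N0 mulr1 => /eqP->; rewrite abszN.
apply: (@leq_trans (\sum_(d < n.+1) q ^ (2 * d).+1 * q ^ b n.+1)%N); last first.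
  by rewrite -big_distrl expnD leq_mul2r sum_geometric_le // orbT.
rewrite (leq_trans (leq_mul (absz_sum_le _) (leqnn _))) // big_distrl /=.
apply: leq_sum => d _; rewrite abszM mulnAC.
apply: leq_trans (leq_mul (IHn d (ltn_ord d)) (Nk_le F k (n.+1 - d))) _.
rewrite -!expnD leq_exp2l // -addnA addSn -addnS leq_add2l.
by have := nb_monomials_superadditive k d (n.+1 - d); rewrite subnKC // ltnW.
Qed.

(** One factor [q] is lost in superadditivity, the other between the upper bound [q ^ b] and the
    lower bound [q ^ (b - 1)]. *)
Lemma Nk_shift_le j e u : (0 < k)%N -> (e <= j)%N ->
  (Nk F k (j - e + u)%N * q ^ b e <= q ^ 2 * Nk F k (j + u)%N)%N.
Proof.
move=> k_gt0 e_j; have q_gt1 : (1 < q)%N by apply: card_finNzRing_gt1.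
apply: (@leq_trans (q ^ (b (j - e + u) + b e))%N).
  by rewrite expnD leq_mul2r Nk_le orbT.
have := nb_monomials_superadditive k (j - e + u) e.
rewrite addnAC subnK // => b_le.
apply: (@leq_trans (q ^ (b (j + u)).+1)); first by rewrite leq_exp2l.
have := Nk_ge F (j + u) k_gt0; have := nb_monomials_gt0 k (j + u).
case: (b (j + u)) => // c _ /= le_N.
by rewrite -addn2 addnC expnD leq_mul2l le_N orbT.
Qed.

(** The two shifts of [N] gain [q ^ (2 b e)] against the bound on [A(T + e)]. Of the slack [3 e],
    two parts pay for [q ^ (2 e)] in that bound and one for the decay [2 ^ - e]. The 4 in the
    exponent comes from using [Nk_shift_le] twice. *)
Lemma tail_le T K j u v : (0 < k)%N ->
    (forall e, b (e + T) + 3 * e <= 2 * b e + K)%N ->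
  (\sum_(e < j.+1) `|Ak F k (T + e)| * (Nk F k (j - e + u)%N * Nk F k (j - e + v)%N)
    <= 2 * (q ^ (2 * T + K + 4) * (Nk F k (j + u)%N * Nk F k (j + v)%N)))%N.
Proof.
move=> k_gt0 growth; have q_gt1 : (1 < q)%N by apply: card_finNzRing_gt1.
apply: (sum_dominated_le (X := fun e => (`|Ak F k (T + e)|
  * (Nk F k (j - e + u)%N * Nk F k (j - e + v)%N))%N)) => e; rewrite ltnS => e_j.
have Nu := Nk_shift_le u k_gt0 e_j; have Nv := Nk_shift_le v k_gt0 e_j.
have Ae : (`|Ak F k (T + e)| * 2 ^ e <= q ^ (2 * T + K + 2 * b e))%N.
  apply: (@leq_trans (q ^ (2 * (T + e) + b (T + e)) * q ^ e)%N).
    apply: leq_mul; last by have [-> //|e_gt0] := posnP e; rewrite leq_exp2r.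
    by apply: leq_trans (Ak_le _); rewrite leq_pmulr // ltnW.
  by rewrite -expnD leq_exp2l //; have := growth e; rewrite [(e + T)%N]addnC; lia.
rewrite -(@leq_pmul2r (q ^ (2 * b e))) ?expn_gt0 ?(ltnW q_gt1) //.
have sqE x : (q ^ (2 * x) = q ^ x * q ^ x)%N by rewrite mul2n -addnn expnD.
have := leq_mul Ae (leq_mul Nu Nv).
rewrite (expnD q (2 * T + K) (2 * b e)) (expnD q (2 * T + K) 4) (sqE (b e)) (sqE 2).
move: (q ^ (2 * T + K))%N (q ^ 2)%N (q ^ b e)%N => x z B.
move: (Nk F k _) (Nk F k _) (Nk F k _) (Nk F k _) => N1 N2 N3 N4.
by congr (_ <= _)%N; ring.
Qed.

Lemma Nk_sub (m d : nat) : Nk F k (m%:Z - d%:Z) = if (d <= m)%N then Nk F k (m - d)%N else 0%N.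
Proof.
case: leqP => [d_m|m_d]; first by rewrite subzn.
by rewrite -opprB subzn ?(ltnW m_d) //; case: (d - m)%N (subn_gt0 m d) => [|n]; rewrite ?m_d.
Qed.

Lemma Pk_approximation t K m n : (0 < k)%N ->
    (forall e, b (e + t.+1) + 3 * e <= 2 * b e + K)%N ->
  (`|((Pk F k m n)%:Z - \sum_(d < t.+1)
      (Nk F k (m%:Z - d%:Z))%:Z * (Nk F k (n%:Z - d%:Z))%:Z * Ak F k d)%R|
   <= 2 * q ^ (2 * t.+1 + K + 4) *
      Nk F k (m%:Z - t%:Z - 1)%R * Nk F k (n%:Z - t%:Z - 1)%R)%N.
Proof.
move=> k_gt0 growth.
pose i := minn m n; pose u := (m - n)%N; pose v := (n - m)%N.
have mE : m = (i + u)%N by rewrite /i /u; lia.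
have nE : n = (i + v)%N by rewrite /i /v; lia.
have uv : (u == 0%N) || (v == 0%N) by rewrite /u /v; lia.
move: i u v uv mE nE => i u v uv -> -> {m n}.
have sub1 (z : nat) : z%:Z - t%:Z - 1 = z%:Z - t.+1%:Z by lia.
rewrite !sub1 Pk_convolution // /convolution.
pose f d := Ak F k d * ((Nk F k (i - d + u)%N)%:Z * (Nk F k (i - d + v)%N)%:Z).
have termE d : (d <= i)%N ->
    (Nk F k ((i + u)%N%:Z - d%:Z))%:Z * (Nk F k ((i + v)%N%:Z - d%:Z))%:Z * Ak F k d = f d.
  move=> d_i; rewrite !Nk_sub !(leq_trans d_i) ?leq_addr //.
  by rewrite -!addnBAC // mulrC.
have term0 d : (i < d)%N ->
    (Nk F k ((i + u)%N%:Z - d%:Z))%:Z * (Nk F k ((i + v)%N%:Z - d%:Z))%:Z * Ak F k d = 0.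
  move=> i_d; rewrite !Nk_sub; case/orP: uv => /eqP->.
    by rewrite addn0 leqNgt i_d !mul0r.
  by rewrite addn0 [(d <= i)%N]leqNgt i_d mulr0 mul0r.
(* If the smaller degree [i] is at most [t], the terms with [d > i] vanish and the sum is already
   exact. *)
have [i_t|t_i] := leqP i t.
  rewrite -(subnKC (i_t : i.+1 <= t.+1)%N) big_split_ord /=.
  rewrite [X in _ - (_ + X)]big1 ?addr0 => [|d _]; last by rewrite term0 ?ltnS ?leq_addr.
  rewrite [X in _ - X](eq_bigr (fun d : 'I_i.+1 => f d)) => [|d _]; first by rewrite subrr.
  by rewrite termE // -ltnS.
(* Otherwise the difference is the tail of the exact formula, indexed by [d = t.+1 + e] with
   [e <= j]. *)
pose j := (i - t.+1)%N; have iE : i = (t.+1 + j)%N by rewrite /j; lia.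
rewrite [X in _ - X](eq_bigr (fun d : 'I_t.+1 => f d)) => [|d _]; last first.
  by rewrite termE // (leq_trans _ t_i) // ltnW.
rewrite (eq_bigr (fun d : 'I_i.+1 => f d)) // -(big_mkord xpredT f) iE.
rewrite -addnS big_mkord big_split_ord /= [X in X - _]addrC addrK.
rewrite (leq_trans (absz_sum_le _)) //.
have subE w : Nk F k ((t.+1 + j + w)%N%:Z - t.+1%:Z) = Nk F k (j + w)%N.
  by rewrite Nk_sub -addnA leq_addr addKn.
rewrite !subE -mulnA -mulnA; apply: leq_trans (tail_le j u v k_gt0 growth).
apply: leq_sum => e _; rewrite /f !abszM /= iE.
by rewrite subnDl.
Qed.

End Tail.

Theorem theorem4p2 (q k t : nat)
    (hq : exists p e : nat, [/\ prime p, (0 < e)%N & q = (p ^ e)%N])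
    (hk : (2 <= k)%N) :
  exists C : rat, forall (F : finFieldType), #|F| = q ->
  forall m n : nat,
    `| ((Pk F k m n)%:Z
        - \sum_(d < t.+1)
            (Nk F k (m%:Z - d%:Z))%:Z * (Nk F k (n%:Z - d%:Z))%:Z * Ak F k d)%:~R |
    <= C * (Nk F k (m%:Z - t%:Z - 1))%:R * (Nk F k (n%:Z - t%:Z - 1))%:R.
Proof.
have [K growth] := nb_monomials_linear t.+1 3 hk.
(* [K] comes from [k] and [t] alone, so the constant is fixed before [F], [m] and [n]. *)
exists (2 * q ^ (2 * t.+1 + K + 4))%N%:R => F <- m n.
rewrite -intr_norm -abszE -!natrM -pmulrn ler_nat.
by apply: Pk_approximation => //; apply: ltnW.
Qed.
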